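(* Let $K$ be a field with $\mathrm{char}(K)\neq 2$ and let $\mathfrak{g}$ be a free non-abelian Lie algebra over $K$ of rank at least $3$. Then $\chi(\mathfrak{g})$ is of infinite cohomological dimension.
   Context: For a Lie algebra $\mathfrak{g}$ over $K$, let $\mathfrak{g}^{\psi}$ be an isomorphic copy of $\mathfrak{g}$ via $x\mapsto x^{\psi}$, and let $\chi(\mathfrak{g})=\langle \mathfrak{g},\mathfrak{g}^{\psi} \mid [x,x^{\psi}]=0 \text{ for all } x\in\mathfrak{g}\rangle$ (the quotient of the free product of the Lie algebras $\mathfrak{g}$ and $\mathfrak{g}^{\psi}$ by the ideal generated by all $[x,x^{\psi}]$). The cohomological dimension of a Lie algebra over $K$ is the projective dimension of the trivial module $K$ over its universal enveloping algebra. *)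

(* Defs.v *)
From HB Require Import structures.
From mathcomp Require Import all_boot all_algebra.
From mathcomp Require Import boolp.

Set Implicit Arguments.
Unset Strict Implicit.
Unset Printing Implicit Defensive.

Import GRing.Theory.
Local Open Scope ring_scope.
Local Open Scope quotient_scope.

HB.mixin Record Lmodule_isLie (K : fieldType) (L : Type) of GRing.Lmodule K L
    := {
  lbr : L -> L -> L;
  lbr_linearl : forall z, linear (lbr^~ z);
  lbr_linearr : forall z, linear (lbr z);
  lbrxx : forall x, lbr x x = 0;
  lbr_jacobi : forall x y z,
    lbr x (lbr y z) + lbr y (lbr z x) + lbr z (lbr x y) = 0
}.

#[short(type="lieAlgType")]
HB.structure Definition LieAlgebra (K : fieldType) :=
  {L of GRing.Lmodule K L & Lmodule_isLie K L}.

Definition lie_morphism (K : fieldType) (g h : lieAlgType K) (f : g -> h) :=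
  linear f /\ {morph f : x y / lbr x y}.

Definition lie_abelian (K : fieldType) (g : lieAlgType K) :=
  forall x y : g, lbr x y = 0.

(* g is free on the family i; the rank of g is then the cardinality of X. *)
Definition free_on (K : fieldType) (g : lieAlgType K) (X : Type) (i : X -> g) :=
  forall (h : lieAlgType K) (f : X -> h),
  exists2 F : g -> h,
    lie_morphism F /\ (forall x, F (i x) = f x)
  & forall F' : g -> h,
      lie_morphism F' -> (forall x, F' (i x) = f x) -> F' =1 F.

Section Terms.
Variables (K : fieldType) (X : Type).

Inductive term :=
| Gen of X
| Zero
| Add of term & term
| Opp of term
| Scale of K & term
| Mul of term & term.

(* The least congruence that contains E and makes the terms a vector space    *)
(* with a bilinear product.                                                   *)
Inductive term_eq (E : term -> term -> Prop) : term -> term -> Prop :=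
| Te_rel s t : E s t -> term_eq E s t
| Te_refl s : term_eq E s s
| Te_sym s t : term_eq E s t -> term_eq E t s
| Te_trans s t u : term_eq E s t -> term_eq E t u -> term_eq E s u
| Te_add s s' t t' :
    term_eq E s s' -> term_eq E t t' -> term_eq E (Add s t) (Add s' t')
| Te_opp s s' : term_eq E s s' -> term_eq E (Opp s) (Opp s')
| Te_scale a s s' : term_eq E s s' -> term_eq E (Scale a s) (Scale a s')
| Te_mul s s' t t' :
    term_eq E s s' -> term_eq E t t' -> term_eq E (Mul s t) (Mul s' t')
| Te_addA s t u : term_eq E (Add s (Add t u)) (Add (Add s t) u)
| Te_addC s t : term_eq E (Add s t) (Add t s)
| Te_add0 s : term_eq E (Add Zero s) s
| Te_addN s : term_eq E (Add (Opp s) s) Zero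
| Te_scaleA a b s : term_eq E (Scale a (Scale b s)) (Scale (a * b) s)
| Te_scale1 s : term_eq E (Scale 1 s) s
| Te_scaleDr a s t :
    term_eq E (Scale a (Add s t)) (Add (Scale a s) (Scale a t))
| Te_scaleDl a b s :
    term_eq E (Scale (a + b) s) (Add (Scale a s) (Scale b s))
| Te_mull a s t u :
    term_eq E (Mul (Add (Scale a s) t) u) (Add (Scale a (Mul s u)) (Mul t u))
| Te_mulr a s t u :
    term_eq E (Mul u (Add (Scale a s) t)) (Add (Scale a (Mul u s)) (Mul u t)).

HB.instance Definition _ := gen_eqMixin term.
HB.instance Definition _ := gen_choiceMixin term.

Fixpoint eval (A : lmodType K) (m : A -> A -> A) (f : X -> A) (t : term) : A :=
  match t with
  | Gen x => f x
  | Zero => 0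
  | Add s t => eval m f s + eval m f t
  | Opp s => - eval m f s
  | Scale a s => a *: eval m f s
  | Mul s t => m (eval m f s) (eval m f t)
  end.

End Terms.

Arguments Zero {K X}.
Arguments Gen {K X}.

Section Pres.
Variables (K : fieldType) (X : Type) (E : term K X -> term K X -> Prop).

Let e : rel (term K X) := fun s t => `[< term_eq E s t >].

Fact term_eq_refl : reflexive e.
Proof. by move=> s; apply/asboolP/Te_refl. Qed.
Fact term_eq_sym : symmetric e.
Proof. by move=> s t; apply/asboolP/asboolP; apply: Te_sym. Qed.
Fact term_eq_trans : transitive e.
Proof. by move=> t s u /asboolP st /asboolP tu; apply/asboolP/(Te_trans st). Qed.

Definition term_equiv := EquivRel e term_eq_refl term_eq_sym term_eq_trans.

Definition pres : Type := {eq_quot term_equiv}.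
HB.instance Definition _ := Choice.on pres.

Definition pcls (t : term K X) : pres := \pi_({eq_quot term_equiv}) t.
Definition prep (x : pres) : term K X := repr (x : {eq_quot term_equiv}).

Lemma prepK x : pcls (prep x) = x. Proof. exact: reprK. Qed.
Lemma pclsP s t : pcls s = pcls t <-> term_eq E s t.
Proof.
split=> [st|st].
  by have /eqP := st; rewrite /pcls eqmodE => /asboolP.
by apply/eqP; rewrite /pcls eqmodE; apply/asboolP.
Qed.
Lemma prep_pcls t : term_eq E (prep (pcls t)) t.
Proof. by apply/pclsP; rewrite prepK. Qed.
Lemma pcls_ind (P : pres -> Prop) : (forall t, P (pcls t)) -> forall x, P x.
Proof. by move=> h x; rewrite -[x]prepK. Qed.

Definition padd x y := pcls (Add (prep x) (prep y)).
Definition popp x := pcls (Opp (prep x)).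
Definition pscale a x := pcls (Scale a (prep x)).
Definition pmul x y := pcls (Mul (prep x) (prep y)).
Definition pgen x := pcls (Gen x).

Lemma pclsD s t : pcls (Add s t) = padd (pcls s) (pcls t).
Proof. by apply/pclsP/Te_sym/Te_add; apply: prep_pcls. Qed.
Lemma pclsN s : pcls (Opp s) = popp (pcls s).
Proof. by apply/pclsP/Te_sym/Te_opp; apply: prep_pcls. Qed.
Lemma pclsZ a s : pcls (Scale a s) = pscale a (pcls s).
Proof. by apply/pclsP/Te_sym/Te_scale; apply: prep_pcls. Qed.
Lemma pclsM s t : pcls (Mul s t) = pmul (pcls s) (pcls t).
Proof. by apply/pclsP/Te_sym/Te_mul; apply: prep_pcls. Qed.

Fact paddA : associative padd.
Proof.
elim/pcls_ind=> s; elim/pcls_ind=> t; elim/pcls_ind=> u.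
by rewrite -!pclsD; apply/pclsP/Te_addA.
Qed.
Fact paddC : commutative padd.
Proof.
by elim/pcls_ind=> s; elim/pcls_ind=> t; rewrite -!pclsD; apply/pclsP/Te_addC.
Qed.
Fact padd0 : left_id (pcls Zero) padd.
Proof. by elim/pcls_ind=> s; rewrite -pclsD; apply/pclsP/Te_add0. Qed.
Fact paddN : left_inverse (pcls Zero) popp padd.
Proof. by elim/pcls_ind=> s; rewrite -pclsN -pclsD; apply/pclsP/Te_addN. Qed.

HB.instance Definition _ := GRing.isZmodule.Build pres paddA paddC padd0 paddN.

Fact pscaleA a b x : pscale a (pscale b x) = pscale (a * b) x.
Proof. by elim/pcls_ind: x => s; rewrite -!pclsZ; apply/pclsP/Te_scaleA. Qed.
Fact pscale1 : left_id 1 pscale.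
Proof. by elim/pcls_ind=> s; rewrite -pclsZ; apply/pclsP/Te_scale1. Qed.
Fact pscaleDr : right_distributive pscale +%R.
Proof.
move=> a; elim/pcls_ind=> s; elim/pcls_ind=> t.
by rewrite -[_ + _]pclsD -!pclsZ -[RHS]pclsD; apply/pclsP/Te_scaleDr.
Qed.
Fact pscaleDl x : {morph pscale^~ x : a b / a + b}.
Proof.
move=> a b; elim/pcls_ind: x => s.
by rewrite -!pclsZ -[RHS]pclsD; apply/pclsP/Te_scaleDl.
Qed.

HB.instance Definition _ :=
  GRing.Zmodule_isLmodule.Build K pres pscaleA pscale1 pscaleDr pscaleDl.

Lemma pcls0 : pcls Zero = 0. Proof. by []. Qed.
Lemma pcls_add s t : pcls (Add s t) = pcls s + pcls t.
Proof. exact: pclsD. Qed.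
Lemma pcls_opp s : pcls (Opp s) = - pcls s. Proof. exact: pclsN. Qed.
Lemma pcls_scale a s : pcls (Scale a s) = a *: pcls s.
Proof. exact: pclsZ. Qed.

Lemma pmul_linearl z : linear (pmul^~ z).
Proof.
move=> a; elim/pcls_ind=> s; elim/pcls_ind=> t; elim/pcls_ind: z => u.
rewrite /= -pcls_scale -pcls_add -!pclsM -pcls_scale -pcls_add.
exact/pclsP/Te_mull.
Qed.
Lemma pmul_linearr z : linear (pmul z).
Proof.
move=> a; elim/pcls_ind=> s; elim/pcls_ind=> t; elim/pcls_ind: z => u.
rewrite /= -pcls_scale -pcls_add -!pclsM -pcls_scale -pcls_add.
exact/pclsP/Te_mulr.
Qed.

Section Lift.
Variables (A : lmodType K) (m : A -> A -> A) (f : X -> A).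
Hypothesis m_linearl : forall z, linear (m^~ z).
Hypothesis m_linearr : forall z, linear (m z).
Hypothesis mE : forall s t, E s t -> eval m f s = eval m f t.

Definition plift (x : pres) : A := eval m f (prep x).

Lemma eval_term_eq s t : term_eq E s t -> eval m f s = eval m f t.
Proof.
elim=> {s t} //=.
- by move=> s t u _ -> _ ->.
- by move=> s s' t t' _ -> _ ->.
- by move=> s s' _ ->.
- by move=> a s s' _ ->.
- by move=> s s' t t' _ -> _ ->.
- by move=> s t u; rewrite addrA.
- by move=> s t; rewrite addrC.
- by move=> s; rewrite add0r.
- by move=> s; rewrite addNr.
- by move=> a b s; rewrite scalerA.
- by move=> s; rewrite scale1r.
- by move=> a s t; rewrite scalerDr.
- by move=> a b s; rewrite scalerDl.
- by move=> a s t u; apply: m_linearl.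
- by move=> a s t u; apply: m_linearr.
Qed.

Lemma plift_cls t : plift (pcls t) = eval m f t.
Proof. exact/eval_term_eq/prep_pcls. Qed.

Lemma plift_gen x : plift (pgen x) = f x.
Proof. exact: plift_cls. Qed.

Lemma plift_linear : linear plift.
Proof.
move=> a; elim/pcls_ind=> s; elim/pcls_ind=> t.
by rewrite -pcls_scale -pcls_add !plift_cls.
Qed.

Lemma pliftM x y : plift (pmul x y) = m (plift x) (plift y).
Proof.
by elim/pcls_ind: x => s; elim/pcls_ind: y => t; rewrite -pclsM !plift_cls.
Qed.

Lemma plift_unique (F : pres -> A) :
    linear F -> (forall x y, F (pmul x y) = m (F x) (F y)) ->
  (forall x, F (pgen x) = f x) -> F =1 plift.
Proof.
move=> Flin FM Fgen.
have F0 : F 0 = 0.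
  have := Flin 1 0 0; rewrite !scale1r addr0 => /eqP.
  by rewrite -subr_eq subrr eq_sym => /eqP.
have FZ a x : F (a *: x) = a *: F x.
  by rewrite -[a *: x]addr0 Flin F0 addr0.
have FD x y : F (x + y) = F x + F y.
  by rewrite -[x]scale1r Flin !scale1r.
have FN x : F (- x) = - F x.
  by apply/eqP; rewrite -addr_eq0 -FD addNr F0.
elim/pcls_ind=> t; rewrite plift_cls.
elim: t => [x||s IHs t IHt|s IHs|a s IHs|s IHs t IHt] /=.
- exact: Fgen.
- exact: F0.
- by rewrite pcls_add FD IHs IHt.
- by rewrite pcls_opp FN IHs.
- by rewrite pcls_scale FZ IHs.
- by rewrite pclsM FM IHs IHt.
Qed.

End Lift.
End Pres.

Section LiePres.
Variables (K : fieldType) (X : Type) (S : term K X -> term K X -> Prop).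

Inductive lie_rel : term K X -> term K X -> Prop :=
| Lr_rel s t : S s t -> lie_rel s t
| Lr_alt s : lie_rel (Mul s s) Zero
| Lr_jacobi s t u :
    lie_rel (Add (Add (Mul s (Mul t u)) (Mul t (Mul u s))) (Mul u (Mul s t)))
            Zero.

Definition lie_pres : Type := pres lie_rel.
HB.instance Definition _ := GRing.Lmodule.on lie_pres.

Fact lie_presxx (x : lie_pres) : pmul x x = 0.
Proof. by elim/pcls_ind: x => s; rewrite -pclsM; apply/pclsP/Te_rel/Lr_alt. Qed.

Fact lie_pres_jacobi (x y z : lie_pres) :
  pmul x (pmul y z) + pmul y (pmul z x) + pmul z (pmul x y) = 0.
Proof.
elim/pcls_ind: x => s; elim/pcls_ind: y => t; elim/pcls_ind: z => u.
rewrite -!pclsM -!pcls_add.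
exact/pclsP/Te_rel/Lr_jacobi.
Qed.

HB.instance Definition _ := Lmodule_isLie.Build K lie_pres
  (@pmul_linearl _ _ _) (@pmul_linearr _ _ _) lie_presxx lie_pres_jacobi.

Definition lie_gen (x : X) : lie_pres := pgen lie_rel x.

Lemma lie_pres_rel s t : S s t -> pcls lie_rel s = pcls lie_rel t.
Proof. by move=> st; apply/pclsP/Te_rel/Lr_rel. Qed.

Lemma lie_pres_lift (h : lieAlgType K) (f : X -> h) :
    (forall s t, S s t -> eval lbr f s = eval lbr f t) ->
  exists2 F : lie_pres -> h,
    lie_morphism F /\ (forall x, F (lie_gen x) = f x)
  & forall F' : lie_pres -> h,
      lie_morphism F' -> (forall x, F' (lie_gen x) = f x) -> F' =1 F.
Proof.
move=> fS.
have ll := @lbr_linearl _ h; have lr := @lbr_linearr _ h.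
have fE s t : lie_rel s t -> eval lbr f s = eval lbr f t.
  by case=> {s t} [s t /fS|s|s t u] //=; [apply: lbrxx | apply: lbr_jacobi].
exists (plift lbr f).
  split; last exact: plift_gen.
  by split; [apply: plift_linear | apply: pliftM].
by move=> F' [F'lin F'M] F'gen; apply: plift_unique.
Qed.

End LiePres.

Definition free_lie (K : fieldType) (X : Type) : lieAlgType K :=
  @lie_pres K X (fun _ _ => False).

Lemma free_lieP (K : fieldType) (X : Type) :
  @free_on K (free_lie K X) X (@lie_gen K X _).
Proof. by move=> h f; apply: lie_pres_lift. Qed.

Section FreeProduct.
Variables (K : fieldType) (g h : lieAlgType K).

Inductive fprod_rel : term K (g + h) -> term K (g + h) -> Prop :=
| Fp_linearl a x y :
    fprod_rel (Gen (inl (a *: x + y)))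
              (Add (Scale a (Gen (inl x))) (Gen (inl y)))
| Fp_lbrl x y :
    fprod_rel (Gen (inl (lbr x y))) (Mul (Gen (inl x)) (Gen (inl y)))
| Fp_linearr a x y :
    fprod_rel (Gen (inr (a *: x + y)))
              (Add (Scale a (Gen (inr x))) (Gen (inr y)))
| Fp_lbrr x y :
    fprod_rel (Gen (inr (lbr x y))) (Mul (Gen (inr x)) (Gen (inr y))).

Definition free_prod : lieAlgType K := lie_pres fprod_rel.

Definition fp_inl (x : g) : free_prod := lie_gen _ (inl x).
Definition fp_inr (x : h) : free_prod := lie_gen _ (inr x).

Lemma fp_inl_morphism : lie_morphism fp_inl.
Proof.
split=> [a x y|x y].
  rewrite [LHS](lie_pres_rel (Fp_linearl a x y)).
  by rewrite [LHS]pcls_add pcls_scale.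
by rewrite [LHS](lie_pres_rel (Fp_lbrl x y)) [LHS]pclsM.
Qed.

Lemma fp_inr_morphism : lie_morphism fp_inr.
Proof.
split=> [a x y|x y].
  rewrite [LHS](lie_pres_rel (Fp_linearr a x y)).
  by rewrite [LHS]pcls_add pcls_scale.
by rewrite [LHS](lie_pres_rel (Fp_lbrr x y)) [LHS]pclsM.
Qed.

Lemma free_prod_lift (l : lieAlgType K) (f1 : g -> l) (f2 : h -> l) :
    lie_morphism f1 -> lie_morphism f2 ->
  exists2 F : free_prod -> l,
    [/\ lie_morphism F, forall x, F (fp_inl x) = f1 x
      & forall x, F (fp_inr x) = f2 x]
  & forall F' : free_prod -> l, lie_morphism F' ->
      (forall x, F' (fp_inl x) = f1 x) -> (forall x, F' (fp_inr x) = f2 x) ->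
      F' =1 F.
Proof.
move=> [f1l f1M] [f2l f2M].
pose f (x : g + h) := match x with inl x => f1 x | inr x => f2 x end.
have [|F [Fm Ff] Fu] := @lie_pres_lift _ _ fprod_rel l f.
  by move=> s t [] //=.
exists F; first by split=> // x; apply: Ff.
by move=> F' F'm F'1 F'2; apply: Fu => // -[].
Qed.

End FreeProduct.

Section LieQuot.
Variables (K : fieldType) (L : lieAlgType K) (S : L -> Prop).

(* Closure under lbr on one side suffices, as lbr is antisymmetric.           *)
Inductive lie_ideal : L -> Prop :=
| Li_gen x : S x -> lie_ideal x
| Li_0 : lie_ideal 0
| Li_linear a x y : lie_ideal x -> lie_ideal y -> lie_ideal (a *: x + y)
| Li_lbr x y : lie_ideal y -> lie_ideal (lbr x y).

Let e : rel L := fun x y => `[< lie_ideal (x - y) >].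

Fact li_D x y : lie_ideal x -> lie_ideal y -> lie_ideal (x + y).
Proof. by move=> ix iy; rewrite -[x]scale1r; apply: Li_linear. Qed.
Fact li_Z a x : lie_ideal x -> lie_ideal (a *: x).
Proof. by move=> ix; rewrite -[_ *: _]addr0; apply: Li_linear ix Li_0. Qed.
Fact li_N x : lie_ideal x -> lie_ideal (- x).
Proof. by move=> ix; rewrite -scaleN1r; apply: li_Z. Qed.

Fact li_refl : reflexive e.
Proof. by move=> x; apply/asboolP; rewrite subrr; apply: Li_0. Qed.
Fact li_sym : symmetric e.
Proof. by move=> x y; apply/asboolP/asboolP => /li_N; rewrite opprB. Qed.
Fact li_trans : transitive e.
Proof.
move=> y x z /asboolP xy /asboolP yz; apply/asboolP.
by have := li_D xy yz; rewrite addrA subrK.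
Qed.

Definition lie_quot_equiv := EquivRel e li_refl li_sym li_trans.

Definition lie_quot : Type := {eq_quot lie_quot_equiv}.
HB.instance Definition _ := Choice.on lie_quot.

Definition lq_pi (x : L) : lie_quot := \pi_({eq_quot lie_quot_equiv}) x.
Definition lq_repr (x : lie_quot) : L := repr (x : {eq_quot lie_quot_equiv}).

Lemma lq_reprK x : lq_pi (lq_repr x) = x. Proof. exact: reprK. Qed.
Lemma lq_piP x y : lq_pi x = lq_pi y <-> lie_ideal (x - y).
Proof.
split=> [xy|xy].
  by have /eqP := xy; rewrite /lq_pi eqmodE => /asboolP.
by apply/eqP; rewrite /lq_pi eqmodE; apply/asboolP.
Qed.
Lemma lq_repr_pi x : lie_ideal (lq_repr (lq_pi x) - x).
Proof. by apply/lq_piP; rewrite lq_reprK. Qed.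
Lemma lq_ind (P : lie_quot -> Prop) : (forall x, P (lq_pi x)) -> forall x, P x.
Proof. by move=> h x; rewrite -[x]lq_reprK. Qed.

Definition lq_add x y := lq_pi (lq_repr x + lq_repr y).
Definition lq_opp x := lq_pi (- lq_repr x).
Definition lq_scale a x := lq_pi (a *: lq_repr x).
Definition lq_lbr x y := lq_pi (lbr (lq_repr x) (lq_repr y)).

Fact lbrBl (x y z : L) : lbr (x - y) z = lbr x z - lbr y z.
Proof. by rewrite addrC -scaleN1r lbr_linearl scaleN1r addrC. Qed.
Fact lbrBr (x y z : L) : lbr z (x - y) = lbr z x - lbr z y.
Proof. by rewrite addrC -scaleN1r lbr_linearr scaleN1r addrC. Qed.
Fact lbrC (x y : L) : lbr x y = - lbr y x.
Proof.
apply/eqP; rewrite -addr_eq0; have /eqP := lbrxx (x - y).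
rewrite lbrBl !lbrBr !lbrxx sub0r subr0 -opprD oppr_eq0.
by rewrite addrC.
Qed.

Lemma lq_piD x y : lq_pi (x + y) = lq_add (lq_pi x) (lq_pi y).
Proof.
apply/esym/lq_piP; rewrite opprD addrACA.
by apply: li_D; apply: lq_repr_pi.
Qed.
Lemma lq_piN x : lq_pi (- x) = lq_opp (lq_pi x).
Proof. by apply/esym/lq_piP; rewrite -opprD; apply/li_N/lq_repr_pi. Qed.
Lemma lq_piZ a x : lq_pi (a *: x) = lq_scale a (lq_pi x).
Proof. by apply/esym/lq_piP; rewrite -scalerBr; apply/li_Z/lq_repr_pi. Qed.
Lemma lq_piM x y : lq_pi (lbr x y) = lq_lbr (lq_pi x) (lq_pi y).
Proof.
apply/esym/lq_piP.
rewrite -(subrK (lbr x (lq_repr (lq_pi y))) (lbr _ _)) -addrA.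
rewrite -lbrBl -lbrBr lbrC.
by apply: li_D; first apply: li_N; apply: Li_lbr; apply: lq_repr_pi.
Qed.

Fact lq_addA : associative lq_add.
Proof.
by elim/lq_ind=> x; elim/lq_ind=> y; elim/lq_ind=> z; rewrite -!lq_piD addrA.
Qed.
Fact lq_addC : commutative lq_add.
Proof. by elim/lq_ind=> x; elim/lq_ind=> y; rewrite -!lq_piD addrC. Qed.
Fact lq_add0 : left_id (lq_pi 0) lq_add.
Proof. by elim/lq_ind=> x; rewrite -lq_piD add0r. Qed.
Fact lq_addN : left_inverse (lq_pi 0) lq_opp lq_add.
Proof. by elim/lq_ind=> x; rewrite -lq_piN -lq_piD addNr. Qed.

HB.instance Definition _ :=
  GRing.isZmodule.Build lie_quot lq_addA lq_addC lq_add0 lq_addN.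

Fact lq_scaleA a b x : lq_scale a (lq_scale b x) = lq_scale (a * b) x.
Proof. by elim/lq_ind: x => x; rewrite -!lq_piZ scalerA. Qed.
Fact lq_scale1 : left_id 1 lq_scale.
Proof. by elim/lq_ind=> x; rewrite -lq_piZ scale1r. Qed.
Fact lq_scaleDr : right_distributive lq_scale +%R.
Proof.
move=> a; elim/lq_ind=> x; elim/lq_ind=> y.
by rewrite -[_ + _]lq_piD -!lq_piZ -[RHS]lq_piD scalerDr.
Qed.
Fact lq_scaleDl x : {morph lq_scale^~ x : a b / a + b}.
Proof.
by move=> a b; elim/lq_ind: x => x; rewrite -!lq_piZ -[RHS]lq_piD scalerDl.
Qed.

HB.instance Definition _ := GRing.Zmodule_isLmodule.Build K lie_quot
  lq_scaleA lq_scale1 lq_scaleDr lq_scaleDl.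

Lemma lq_pi_linear : linear lq_pi.
Proof. by move=> a x y; rewrite lq_piD lq_piZ. Qed.

Fact lq_lbr_linearl z : linear (lq_lbr^~ z).
Proof.
move=> a; elim/lq_ind=> x; elim/lq_ind=> y; elim/lq_ind: z => z.
by rewrite -lq_pi_linear -!lq_piM -lq_pi_linear lbr_linearl.
Qed.
Fact lq_lbr_linearr z : linear (lq_lbr z).
Proof.
move=> a; elim/lq_ind=> x; elim/lq_ind=> y; elim/lq_ind: z => z.
by rewrite -lq_pi_linear -!lq_piM -lq_pi_linear lbr_linearr.
Qed.
Fact lq_lbrxx x : lq_lbr x x = 0.
Proof. by elim/lq_ind: x => x; rewrite -lq_piM lbrxx. Qed.
Fact lq_lbr_jacobi x y z :
  lq_lbr x (lq_lbr y z) + lq_lbr y (lq_lbr z x) + lq_lbr z (lq_lbr x y) = 0.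
Proof.
elim/lq_ind: x => x; elim/lq_ind: y => y; elim/lq_ind: z => z.
by rewrite -!lq_piM -[X in X + _]lq_piD -[LHS]lq_piD lbr_jacobi.
Qed.

HB.instance Definition _ := Lmodule_isLie.Build K lie_quot
  lq_lbr_linearl lq_lbr_linearr lq_lbrxx lq_lbr_jacobi.

Lemma lq_pi_morphism : lie_morphism lq_pi.
Proof. by split; [apply: lq_pi_linear | apply: lq_piM]. Qed.

Lemma lie_quot_lift (l : lieAlgType K) (f : L -> l) :
    lie_morphism f -> (forall x, S x -> f x = 0) ->
  exists2 F : lie_quot -> l,
    lie_morphism F /\ (forall x, F (lq_pi x) = f x)
  & forall F' : lie_quot -> l, (forall x, F' (lq_pi x) = f x) -> F' =1 F.
Proof.
move=> [flin fM] fS.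
have f0 : f 0 = 0.
  have := flin 1 0 0; rewrite !scale1r addr0 => /eqP.
  by rewrite -subr_eq subrr eq_sym => /eqP.
have lbr0 (x : l) : lbr x 0 = 0.
  have := lbr_linearr x 1 0 0; rewrite !scale1r addr0 => /eqP.
  by rewrite -subr_eq subrr eq_sym => /eqP.
have fI x : lie_ideal x -> f x = 0.
  elim=> {x} [x /fS|//|a x y _ fx _ fy|x y _ fy]; first by [].
  - by rewrite flin fx fy scaler0 addr0.
  - by rewrite fM fy lbr0.
have fpi x : f (lq_repr (lq_pi x)) = f x.
  have /fI := lq_repr_pi x; rewrite -[_ - _]addrC -scaleN1r flin scaleN1r.
  by rewrite addrC => /eqP; rewrite subr_eq0 => /eqP.
exists (fun x => f (lq_repr x)); last first.
  by move=> F' F'pi; elim/lq_ind=> x; rewrite F'pi fpi.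
split=> [|x]; last exact: fpi.
split=> [a|]; elim/lq_ind=> x; elim/lq_ind=> y.
  by rewrite -lq_pi_linear !fpi flin.
by rewrite -[lbr _ _]lq_piM !fpi fM.
Qed.

End LieQuot.

Section Chi.
Variables (K : fieldType) (g : lieAlgType K).

(* The second factor of the free product plays the role of the copy g^psi.    *)
Definition chi : lieAlgType K :=
  @lie_quot K (free_prod g g)
    (fun z => exists x : g, z = lbr (fp_inl g x) (fp_inr g x)).

Definition chi_in (x : g) : chi := lq_pi _ (fp_inl g x).
Definition chi_psi (x : g) : chi := lq_pi _ (fp_inr g x).

Lemma lie_morphism_comp (l l' : lieAlgType K) (f : g -> l) (f' : l -> l') :
  lie_morphism f -> lie_morphism f' -> lie_morphism (f' \o f).
Proof.
move=> [fl fM] [f'l f'M]; split=> [a x y|x y] /=; first by rewrite fl f'l.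
by rewrite fM f'M.
Qed.

Lemma chi_in_morphism : lie_morphism chi_in.
Proof.
exact: lie_morphism_comp (fp_inl_morphism _ _) (lq_pi_morphism _).
Qed.
Lemma chi_psi_morphism : lie_morphism chi_psi.
Proof.
exact: lie_morphism_comp (fp_inr_morphism _ _) (lq_pi_morphism _).
Qed.

Lemma chi_comm x : lbr (chi_in x) (chi_psi x) = 0.
Proof.
rewrite -[LHS]lq_piM; apply/lq_piP; rewrite subr0.
by apply: Li_gen; exists x.
Qed.

Lemma chi_lift (l : lieAlgType K) (f1 f2 : g -> l) :
    lie_morphism f1 -> lie_morphism f2 ->
    (forall x, lbr (f1 x) (f2 x) = 0) ->
  exists2 F : chi -> l,
    [/\ lie_morphism F, forall x, F (chi_in x) = f1 x
      & forall x, F (chi_psi x) = f2 x]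
  & forall F' : chi -> l, lie_morphism F' ->
      (forall x, F' (chi_in x) = f1 x) -> (forall x, F' (chi_psi x) = f2 x) ->
      F' =1 F.
Proof.
move=> f1m f2m f12.
have [G [Gm G1 G2] Gu] := free_prod_lift f1m f2m.
have [|F [Fm FG] Fu] := @lie_quot_lift _ _
  (fun z => exists x : g, z = lbr (fp_inl g x) (fp_inr g x)) l G Gm.
  by move=> _ [x ->]; rewrite Gm.2 G1 G2.
exists F; first by split=> // x; rewrite FG.
move=> F' F'm F'1 F'2; apply: Fu => x.
apply: (Gu (fun x => F' (lq_pi _ x))) => //.
have [pl pM] := lq_pi_morphism
  (fun z => exists x : g, z = lbr (fp_inl g x) (fp_inr g x)).
have [F'l F'M] := F'm.
by split=> [a y z|y z]; rewrite ?pl ?F'l ?pM ?F'M.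
Qed.

End Chi.

Section Uenv.
Variables (K : fieldType) (L : lieAlgType K).

(* Gen None is the unit.                                                      *)
Inductive uenv_rel : term K (option L) -> term K (option L) -> Prop :=
| Ur_mulA s t u : uenv_rel (Mul s (Mul t u)) (Mul (Mul s t) u)
| Ur_mul1l s : uenv_rel (Mul (Gen None) s) s
| Ur_mul1r s : uenv_rel (Mul s (Gen None)) s
| Ur_linear a x y :
    uenv_rel (Gen (Some (a *: x + y)))
             (Add (Scale a (Gen (Some x))) (Gen (Some y)))
| Ur_lbr x y :
    uenv_rel (Gen (Some (lbr x y)))
             (Add (Mul (Gen (Some x)) (Gen (Some y)))
                  (Opp (Mul (Gen (Some y)) (Gen (Some x))))).

Definition uenv : Type := pres uenv_rel.
HB.instance Definition _ := GRing.Lmodule.on uenv.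

Definition umul : uenv -> uenv -> uenv := @pmul K (option L) uenv_rel.
Definition uone : uenv := pgen uenv_rel None.

Fact umulA : associative umul.
Proof.
elim/pcls_ind=> s; elim/pcls_ind=> t; elim/pcls_ind=> u; rewrite /umul.
by rewrite -!pclsM; apply/pclsP/Te_rel/Ur_mulA.
Qed.
Fact umul1l : left_id uone umul.
Proof.
by elim/pcls_ind=> s; rewrite /umul -pclsM; apply/pclsP/Te_rel/Ur_mul1l.
Qed.
Fact umul1r : right_id uone umul.
Proof.
by elim/pcls_ind=> s; rewrite /umul -pclsM; apply/pclsP/Te_rel/Ur_mul1r.
Qed.
Fact umulDl : left_distributive umul +%R.
Proof.
by move=> x y z; have := pmul_linearl z 1 x y; rewrite !scale1r.
Qed.
Fact umulDr : right_distributive umul +%R.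
Proof.
by move=> x y z; have := pmul_linearr x 1 y z; rewrite !scale1r.
Qed.

Fact uone_neq0 : uone != 0.
Proof.
pose f (x : option L) : K^o := if x is None then 1 else 0.
apply/eqP => /(congr1 (plift *%R f)).
have ml (z : K^o) : linear ( *%R^~ z : K^o -> K^o).
  by move=> a x y; rewrite mulrDl scalerAl.
have mr (z : K^o) : linear ( *%R z : K^o -> K^o).
  by move=> a x y; rewrite mulrDr scalerAr.
have fE s t : uenv_rel s t -> eval *%R f s = eval *%R f t.
  case=> {s t} /= [s t u|s|s|a x y|x y].
  - by rewrite mulrA.
  - by rewrite mul1r.
  - by rewrite mulr1.
  - by rewrite scaler0 addr0.
  - by rewrite mulr0 subr0.
rewrite plift_gen // -(pcls0 uenv_rel) plift_cls //= => /eqP.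
by rewrite oner_eq0.
Qed.

HB.instance Definition _ := GRing.Zmodule_isNzRing.Build uenv
  umulA umul1l umul1r umulDl umulDr uone_neq0.

Fact uscaleAl (a : K) (x y : uenv) : a *: (x * y) = a *: x * y.
Proof.
rewrite -(addr0 (a *: x)) [RHS](pmul_linearl y a x 0).
by have -> : pmul 0 y = 0 :> uenv; [apply: mul0r | rewrite addr0].
Qed.
HB.instance Definition _ :=
  GRing.Lmodule_isLalgebra.Build K uenv uscaleAl.

Fact uscaleAr (a : K) (x y : uenv) : a *: (x * y) = x * (a *: y).
Proof.
rewrite -(addr0 (a *: y)) [RHS](pmul_linearr x a y 0).
by have -> : pmul x 0 = 0 :> uenv; [apply: mulr0 | rewrite addr0].
Qed.
HB.instance Definition _ := GRing.Lalgebra_isAlgebra.Build K uenv uscaleAr.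

Definition uenv_in (x : L) : uenv := pgen uenv_rel (Some x).

Lemma uenv_in_linear : linear uenv_in.
Proof.
move=> a x y; rewrite /uenv_in /pgen -pcls_scale -pcls_add.
exact/pclsP/Te_rel/Ur_linear.
Qed.
Lemma uenv_in_lbr x y :
  uenv_in (lbr x y) = uenv_in x * uenv_in y - uenv_in y * uenv_in x.
Proof.
have M s t : pcls uenv_rel (Mul s t) = (pcls _ s : uenv) * (pcls _ t : uenv).
  exact: pclsM.
have N s : pcls uenv_rel (Opp s) = - (pcls _ s : uenv) by exact: pcls_opp.
have D s t : pcls uenv_rel (Add s t) = (pcls _ s : uenv) + (pcls _ t : uenv).
  exact: pcls_add.
by rewrite /uenv_in /pgen -!M -N -D; apply/pclsP/Te_rel/Ur_lbr.
Qed.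

Section Lift.
Variables (A : algType K) (f : L -> A).

Definition uenv_lift : uenv -> A :=
  plift *%R (fun x => if x is Some x then f x else 1).

Hypothesis f_linear : linear f.
Hypothesis f_lbr : forall x y, f (lbr x y) = f x * f y - f y * f x.

Let ml (z : A) : linear ( *%R^~ z : A -> A).
Proof. by move=> a x y; rewrite mulrDl scalerAl. Qed.
Let mr (z : A) : linear ( *%R z : A -> A).
Proof. by move=> a x y; rewrite mulrDr scalerAr. Qed.
Let fE s t : uenv_rel s t ->
  eval *%R (fun x => if x is Some x then f x else 1 : A) s =
  eval *%R (fun x => if x is Some x then f x else 1 : A) t.
Proof.
case=> {s t} /= [s t u|s|s|a x y|x y].
- by rewrite mulrA.
- by rewrite mul1r.
- by rewrite mulr1.
- by rewrite f_linear.
- by rewrite f_lbr.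
Qed.

Lemma uenv_lift_linear : linear uenv_lift.
Proof. exact: plift_linear. Qed.
Lemma uenv_lift1 : uenv_lift 1 = 1.
Proof. exact: plift_gen. Qed.
Lemma uenv_liftM : {morph uenv_lift : x y / x * y}.
Proof. exact: pliftM. Qed.
Lemma uenv_lift_in x : uenv_lift (uenv_in x) = f x.
Proof. by rewrite /uenv_lift /uenv_in plift_gen. Qed.
Lemma uenv_lift_unique (F : {lrmorphism uenv -> A}) :
  (forall x, F (uenv_in x) = f x) -> F =1 uenv_lift.
Proof.
move=> Ff; apply: plift_unique => //.
- by move=> a x y; apply: (linearP F a x y).
- by move=> x y; apply: (rmorphM F x y).
- by case=> [x|]; [apply: Ff | apply: (rmorph1 F)].
Qed.

End Lift.

(* The augmentation: the algebra morphism to K that kills L.                  *)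
Definition augm : uenv -> K := @uenv_lift K^o (fun _ => 0).

Let zero_linear : linear (fun _ : L => 0 : K^o).
Proof. by move=> a x y; rewrite scaler0 addr0. Qed.
Let zero_lbr (x y : L) : 0 = 0 * 0 - 0 * 0 :> K^o.
Proof. by rewrite mulr0 subr0. Qed.

Lemma augmD : {morph augm : x y / x + y}.
Proof.
move=> x y; have := uenv_lift_linear zero_linear zero_lbr 1 x y.
by rewrite !scale1r.
Qed.
Lemma augmM : {morph augm : x y / x * y}.
Proof. exact: (uenv_liftM zero_linear zero_lbr). Qed.
Lemma augm1 : augm 1 = 1.
Proof. exact: (uenv_lift1 zero_linear zero_lbr). Qed.
Lemma augm_in x : augm (uenv_in x) = 0.
Proof. exact: (uenv_lift_in zero_linear zero_lbr). Qed.

End Uenv.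

Definition triv_mod (K : fieldType) (L : lieAlgType K) : Type := K.
HB.instance Definition _ (K : fieldType) (L : lieAlgType K) :=
  GRing.Zmodule.copy (triv_mod L) K.

Section TrivMod.
Variables (K : fieldType) (L : lieAlgType K).

Definition triv_scale (u : uenv L) (k : triv_mod L) : triv_mod L :=
  augm u * (k : K).

Fact triv_scaleA u v k : triv_scale u (triv_scale v k) = triv_scale (u * v) k.
Proof. by rewrite /triv_scale augmM mulrA. Qed.
Fact triv_scale1 : left_id 1 triv_scale.
Proof. by move=> k; rewrite /triv_scale augm1 mul1r. Qed.
Fact triv_scaleDr : right_distributive triv_scale +%R.
Proof. by move=> u j k; rewrite /triv_scale mulrDr. Qed.
Fact triv_scaleDl k : {morph triv_scale^~ k : u v / u + v}.
Proof. by move=> u v; rewrite /triv_scale augmD mulrDl. Qed.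

HB.instance Definition _ := GRing.Zmodule_isLmodule.Build (uenv L) (triv_mod L)
  triv_scaleA triv_scale1 triv_scaleDr triv_scaleDl.

End TrivMod.

Definition projective (R : pzRingType) (P : lmodType R) :=
  forall (A B : lmodType R) (p : {linear A -> B}) (f : {linear P -> B}),
    (forall b, exists a, p a = b) ->
  exists F : {linear P -> A}, forall x, p (F x) = f x.

Record proj_resolution (R : pzRingType) (M : lmodType R) := ProjResolution {
  res_mod : nat -> lmodType R;
  res_d : forall n, {linear res_mod n.+1 -> res_mod n};
  res_aug : {linear res_mod 0 -> M};
  res_proj : forall n, projective (res_mod n);
  res_aug_surj : forall m, exists x, res_aug x = m;
  res_exact0 : forall x, res_aug x = 0 <-> exists y, res_d 0 y = x;
  res_exactS : forall n x, res_d n x = 0 <-> exists y, res_d n.+1 y = x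
}.

Definition proj_dim_le (R : pzRingType) (M : lmodType R) (n : nat) :=
  exists P : proj_resolution M,
    forall k, (n < k)%N -> forall x : res_mod P k, x = 0.

Definition cohom_dim_le (K : fieldType) (L : lieAlgType K) (n : nat) :=
  proj_dim_le (triv_mod L : lmodType (uenv L)) n.

Definition infinite_cohom_dim (K : fieldType) (L : lieAlgType K) :=
  forall n, ~ cohom_dim_le L n.

(* Main.v *)
Require Import Defs.
From HB Require Import structures.
From mathcomp Require Import all_boot all_algebra ring.
From mathcomp Require Import boolp.

Set Implicit Arguments.
Unset Strict Implicit.
Unset Printing Implicit Defensive.

Import GRing.Theory.
Local Open Scope ring_scope.

(** A Lie algebra containing commuting elements a_0, a_1, ... has infinite
    cohomological dimension as soon as these are detected by enough one-cocycles:
    the class of the exterior product of N of them is then seen by a cup product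
    of N one-cocycles, so that no projective resolution of K has length below N.

    Commuting elements. In chi(g), write l(x) = x - x^psi.  Since [x, x^psi] = 0
    for all x, the bracket [x, y^psi] is antisymmetric in x and y.  Applying this
    to [[x, y], z^psi] shows that [l(x), [y, z^psi]] is symmetric in x, y; as it
    is also antisymmetric in y, z, it vanishes in characteristic not 2
    ([dif_mixed]).  Hence the ideal generated by the l(x) commutes with the ideal
    generated by the [y, z^psi].  The element
    w = [x, [l(y), z^psi]] = [x, [y, z^psi]] - [x, [y, z]^psi]
    lies in both ideals, and so do all a_k = ad(x)^k w; therefore the a_k commute
    ([chi_orbit_comm]).

    Cocycles. Let R be a commutative K-algebra and let D, A, B : g -> R satisfy
    D[u, v] = 0 and A[u, v] = D(u)A(v) - D(v)A(u), likewise for B; such maps may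
    be prescribed arbitrarily on free generators of g.  Then
       u     |-> (D, 0, 0, 0; 0, D, 0, B; 0, 0, D, -A; 0, 0, 0, 0),
       u^psi |-> (D, A, B, 0; 0, 0, 0, 0; 0, 0, 0, 0; 0, 0, 0, 0)
    (rows of 4 x 4 matrices, everything evaluated at u) is a representation of
    chi(g), because the commutator of the two matrices is -(AB - BA) times the
    upper right elementary matrix.  It sends w to the determinant of (D, A, B) at
    (x, y, z) times that elementary matrix, and the bracket with x multiplies the
    latter by D(x).  For three free generators x, y, z, the triples (D, A, B) can
    be chosen to be (r, 0, 0), (0, 1, 0), (0, 0, 1) with r in R arbitrary, and
    then a_k goes to r^(k+1) times the elementary matrix ([heis_chi_orbit]).  So the a_k act trivially on
    the submodule R^3 and on the quotient R of R^4, but not on R^4.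

    Detection. Take R = K[X].  Given a projective resolution P of K, a Koszul-like
    family p(s) in P_k, indexed by lists s of length k, is built with
    d p(s) = sum over j of (-1)^j a_(s_j) p(s without s_j).  Simultaneously, a
    representation V_k and a linear map P_k -> V_k killing the boundaries are
    built: V_(k+1) is the tensor product of V_k with the above R^3, and the
    extension V_k (x) R^4 of V_k by V_(k+1) lets one shift dimensions, since P_k
    is projective ([heis_dimension_shift]).  The value of this map on p(s) is
    forced: up to sign, it is the determinant of the matrix r_i^(s_j + 1) times a
    fixed torsion-free vector, where r_i is the parameter used at stage i.
    Choosing r_i = X^m with m large enough at each stage keeps this determinant
    nonzero for s = [k-1; ...; 0] ([altsum_neq0]); hence p(s) is nonzero and P_k
    cannot vanish.  Working with modules over the whole enveloping algebra avoids
    restriction to a subalgebra, hence the Poincare-Birkhoff-Witt theorem. *)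

(** * Alternating sums over the entries of a list *)

Section AlternatingSum.
Variable V : zmodType.
Implicit Types (F G : nat -> seq nat -> V) (s t : seq nat).

(** The sum over the positions j of s of (-1)^j F(s_j, s without s_j), that is
    the Koszul differential.  The recursion absorbs the signs and makes the
    double-sum cancellation below an induction without index shifts. *)
Fixpoint altsum F s : V :=
  if s is x :: t then F x t - altsum (fun y u => F y (x :: u)) t else 0.

Lemma eq_altsum F G : (forall x t, F x t = G x t) -> altsum F =1 altsum G.
Proof.
move=> FG s; elim: s F G FG => //= x s IHs F G FG.
by rewrite FG; congr (_ - _); apply: IHs.
Qed.

Lemma altsumB F G s :
  altsum (fun x t => F x t - G x t) s = altsum F s - altsum G s.
Proof.
elim: s F G => [|x s IHs] F G /=; first by rewrite subr0.
by rewrite IHs opprD addrACA -opprD.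
Qed.

(** The identity d o d = 0 of a Koszul complex: the two orders of removing two
    entries come with opposite signs. *)
Lemma altsum_altsum (F : nat -> nat -> seq nat -> V) s :
    (forall x y t, F x y t = F y x t) ->
  altsum (fun x t => altsum (F x) t) s = 0.
Proof.
elim: s F => //= x s IHs F Fsym.
rewrite altsumB (IHs (fun y z u => F y z (x :: u))) // subr0.
by apply/eqP; rewrite subr_eq0; apply/eqP/eq_altsum.
Qed.

End AlternatingSum.

Lemma altsum_morph (V W : zmodType) (f : V -> W) F s :
    {morph f : v w / v - w} ->
  f (altsum F s) = altsum (fun x t => f (F x t)) s.
Proof.
move=> fB; have f0 : f 0 = 0 by rewrite -(subrr 0) fB subrr.
by elim: s F => //= x s IHs F; rewrite fB IHs.
Qed.

(** * Commuting elements of chi(g) *)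

Section LieCalculus.
Variables (K : fieldType) (L : lieAlgType K).
Implicit Types x y z : L.

Lemma lbrDl x y z : lbr (x + y) z = lbr x z + lbr y z.
Proof. by have := lbr_linearl z 1 x y; rewrite !scale1r. Qed.
Lemma lbrDr x y z : lbr z (x + y) = lbr z x + lbr z y.
Proof. by have := lbr_linearr z 1 x y; rewrite !scale1r. Qed.
Lemma lbrx0 x : lbr x 0 = 0.
Proof. by rewrite -[X in lbr x X](subrr 0) lbrBr subrr. Qed.
Lemma lbr0x x : lbr 0 x = 0.
Proof. by rewrite -[X in lbr X x](subrr 0) lbrBl subrr. Qed.
Lemma lbrxN x y : lbr x (- y) = - lbr x y.
Proof. by rewrite -sub0r lbrBr lbrx0 sub0r. Qed.

Lemma lbr_leibnizr x y z : lbr x (lbr y z) = lbr (lbr x y) z + lbr y (lbr x z).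
Proof.
have := lbr_jacobi x y z; rewrite (lbrC z x) lbrxN (lbrC z (lbr x y)).
by move=> /eqP; rewrite subr_eq0 => /eqP <-; rewrite subrK.
Qed.
Lemma lbr_leibnizl x y z : lbr (lbr x y) z = lbr x (lbr y z) - lbr y (lbr x z).
Proof. by rewrite lbr_leibnizr addrK. Qed.

End LieCalculus.

Section ChiIdentities.
Variables (K : fieldType) (g : lieAlgType K).
Hypothesis char_neq2 : 2%N \notin [pchar K].

Local Notation "x ^i" := (chi_in x) (at level 2, format "x ^i").
Local Notation "x ^p" := (chi_psi x) (at level 2, format "x ^p").
Implicit Types (x y z u v : g) (c d : chi g).

Lemma double_eq0 (V : lmodType K) (v : V) : v = - v -> v = 0.
Proof.
move=> vN; have two_neq0 : 2%:R != 0 :> K by move: char_neq2; rewrite inE.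
apply: (scalerI two_neq0); rewrite scaler0 scaler_nat mulr2n.
by rewrite {1}vN addNr.
Qed.

Lemma chi_inD x y : (x + y)^i = x^i + y^i.
Proof. by have := (chi_in_morphism g).1 1 x y; rewrite !scale1r. Qed.
Lemma chi_psiD x y : (x + y)^p = x^p + y^p.
Proof. by have := (chi_psi_morphism g).1 1 x y; rewrite !scale1r. Qed.
Lemma chi_in_lbr x y : (lbr x y)^i = lbr x^i y^i.
Proof. exact: (chi_in_morphism g).2. Qed.
Lemma chi_psi_lbr x y : (lbr x y)^p = lbr x^p y^p.
Proof. exact: (chi_psi_morphism g).2. Qed.

Lemma chi_mixedN x y : lbr x^i y^p = - lbr y^i x^p.
Proof.
have := chi_comm (x + y); rewrite chi_inD chi_psiD lbrDl !lbrDr !chi_comm.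
by rewrite add0r addr0 => /eqP; rewrite addr_eq0 => /eqP.
Qed.

Lemma chi_mixed_sym x y : lbr x^i y^p = lbr x^p y^i.
Proof. by rewrite chi_mixedN -lbrC. Qed.

Definition chi_dif x := x^i - x^p.

(** Compare the expansions, by the Jacobi identity, of [[x, y], z^psi] and of
    [[x, y]^psi, z], which are equal. *)
Lemma dif_mixed_sym x y z :
  lbr (chi_dif x) (lbr y^i z^p) = lbr (chi_dif y) (lbr x^i z^p).
Proof.
have := chi_mixed_sym (lbr x y) z.
rewrite chi_in_lbr chi_psi_lbr !lbr_leibnizl -!chi_mixed_sym => E.
apply/eqP; rewrite -subr_eq0 !lbrBl opprD addrACA -opprD subr_eq0.
exact/eqP.
Qed.

(** A trilinear form symmetric in its first two arguments and antisymmetric in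
    its last two equals its own opposite. *)
Lemma dif_mixed x y z : lbr (chi_dif x) (lbr y^i z^p) = 0.
Proof.
pose T x y z := lbr (chi_dif x) (lbr y^i z^p).
have T12 u v w : T u v w = T v u w by apply: dif_mixed_sym.
have T23 u v w : T u v w = - T u w v by rewrite /T chi_mixedN lbrxN.
apply: double_eq0; rewrite -/(T x y z).
by rewrite [LHS]T12 [LHS]T23 (T12 y z) (T23 z y) opprK (T12 z x) (T23 x z).
Qed.

Definition centralizes_dif c := forall u, lbr (chi_dif u) c = 0.

(** Up to the factor 2, the bracket with v maps l(u) into the subalgebra
    generated by the image of l; this makes the centralizer of that image stable
    under the bracket with v. *)
Lemma lbr_in_dif u v :
  lbr v^i (chi_dif u) + lbr v^i (chi_dif u)
    = lbr (chi_dif v) (chi_dif u) + chi_dif (lbr v u).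
Proof.
rewrite /chi_dif chi_in_lbr chi_psi_lbr lbrBl !lbrBr -(chi_mixed_sym v u).
by rewrite -[RHS]addrA; congr (_ + _); rewrite opprB [RHS]addrC addrA subrK.
Qed.

Lemma centralizes_dif_in c v :
  centralizes_dif c -> centralizes_dif (lbr v^i c).
Proof.
move=> cc u; rewrite lbr_leibnizr cc lbrx0 addr0.
apply: double_eq0; apply/eqP; rewrite -addr_eq0 -lbrDl.
rewrite (lbrC (chi_dif u)) -opprD lbr_in_dif -sub0r lbrBl lbr0x sub0r oppr_eq0.
by rewrite lbrDl lbr_leibnizl !cc !lbrx0 subr0 addr0.
Qed.

Lemma centralizes_dif_psi c v :
  centralizes_dif c -> centralizes_dif (lbr v^p c).
Proof.
move=> cc; have -> : lbr v^p c = lbr v^i c.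
  by apply/eqP; rewrite eq_sym -subr_eq0 -lbrBl; apply/eqP/cc.
exact: centralizes_dif_in.
Qed.

(** The double centralizer of the image of l.  It contains the ideal generated
    by that image, and membership is easier to propagate than an explicit
    description of the ideal. *)
Definition centralized_by_cent d :=
  forall c, centralizes_dif c -> lbr d c = 0.

Lemma centralized_in d v :
  centralized_by_cent d -> centralized_by_cent (lbr v^i d).
Proof.
move=> dc c cc; rewrite lbr_leibnizl dc // lbrx0 sub0r.
by rewrite dc ?oppr0 //; apply: centralizes_dif_in.
Qed.

Lemma centralized_psi d v :
  centralized_by_cent d -> centralized_by_cent (lbr d v^p).
Proof.
move=> dc c cc; rewrite lbr_leibnizl !dc ?lbrx0 ?subr0 //.
exact: centralizes_dif_psi.
Qed.

(** Written with l(y) to be visibly in the ideal generated by the image of l;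
    [chi_altE] exhibits it in the ideal generated by the mixed brackets.  It
    vanishes in the three copies of g onto which chi(g) projects. *)
Definition chi_alt x y z := lbr x^i (lbr (chi_dif y) z^p).

Lemma chi_altE x y z :
  chi_alt x y z = lbr x^i (lbr y^i z^p) - lbr x^i (lbr y z)^p.
Proof. by rewrite /chi_alt /chi_dif lbrBl lbrBr chi_psi_lbr. Qed.

Definition chi_orbit x y z k := iter k (lbr x^i) (chi_alt x y z).

Lemma chi_orbit_comm x y z j k :
  lbr (chi_orbit x y z j) (chi_orbit x y z k) = 0.
Proof.
suff [dj ck] : centralized_by_cent (chi_orbit x y z j) /\
    centralizes_dif (chi_orbit x y z k) by apply: dj.
split.
- elim: j => [|j IHj] /=; last exact: centralized_in.
  by apply/centralized_in/centralized_psi => c; apply.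
- elim: k => [|k IHk] /=; last exact: centralizes_dif_in.
  rewrite chi_altE => u; rewrite lbrBr dif_mixed subr0.
  by apply: centralizes_dif_in => v; apply: dif_mixed.
Qed.

End ChiIdentities.

(** * Two Lie algebras of matrices *)

Section MetaLie.
Variables (K : fieldType) (R : comAlgType K).

(** An opaque factor in place of the scalar action brings the linearity
    conditions below into the language of commutative rings. *)
Lemma scale_as_mul (k : K) : exists a : R, forall r : R, k *: r = a * r.
Proof. by exists k%:A => r; rewrite mulr_algl. Qed.

(** The semidirect product of R acting on R^2 by homotheties, as triples.  A
    morphism into it is a linear form D together with two derivations A and B
    twisted by D. *)
Definition meta : Type := (R * R * R)%type.
HB.instance Definition _ := GRing.Lmodule.on meta.

Lemma meta_eq (x y : meta) :
  x.1.1 = y.1.1 -> x.1.2 = y.1.2 -> x.2 = y.2 -> x = y.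
Proof. by move: x y => [[? ?] ?] [[? ?] ?] /= -> -> ->. Qed.

Definition meta_br (x y : meta) : meta :=
  let: (a, u, v) := x in let: (b, u', v') := y in
  (0, a * u' - b * u, a * v' - b * v).

Fact meta_br_linearl z : linear (meta_br^~ z).
Proof.
move: z => [[a u] v] k [[b u'] v'] [[c u''] v''].
have [k' kE] := scale_as_mul k; apply: meta_eq;
  rewrite /= ?kE; ring.
Qed.
Fact meta_br_linearr z : linear (meta_br z).
Proof.
move: z => [[a u] v] k [[b u'] v'] [[c u''] v''].
have [k' kE] := scale_as_mul k; apply: meta_eq;
  rewrite /= ?kE; ring.
Qed.
Fact meta_brxx x : meta_br x x = 0.
Proof. move: x => [[a u] v]; apply: meta_eq => /=; ring. Qed.
Fact meta_jacobi x y z :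
  meta_br x (meta_br y z) + meta_br y (meta_br z x) + meta_br z (meta_br x y)
    = 0.
Proof.
move: x y z => [[a u] v] [[b u'] v'] [[c u''] v'']; apply: meta_eq => /=; ring.
Qed.

HB.instance Definition _ := Lmodule_isLie.Build K meta
  meta_br_linearl meta_br_linearr meta_brxx meta_jacobi.

(** The tuple (a, e, r, q, c, d, s) is the matrix with rows
      (a, r, q, s), (0, e, 0, c), (0, 0, e, d), (0, 0, 0, 0):
    an oscillator algebra, whose nilpotent part is a Heisenberg algebra with
    center s.  The bracket below is the commutator of these matrices. *)
Definition heis : Type := (R * R * R * R * R * R * R)%type.
HB.instance Definition _ := GRing.Lmodule.on heis.

Lemma heis_eq (x y : heis) :
    x.1.1.1.1.1.1 = y.1.1.1.1.1.1 -> x.1.1.1.1.1.2 = y.1.1.1.1.1.2 ->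
    x.1.1.1.1.2 = y.1.1.1.1.2 -> x.1.1.1.2 = y.1.1.1.2 ->
    x.1.1.2 = y.1.1.2 -> x.1.2 = y.1.2 -> x.2 = y.2 ->
  x = y.
Proof.
move: x y => [[[[[[? ?] ?] ?] ?] ?] ?] [[[[[[? ?] ?] ?] ?] ?] ?] /=.
by do 7 move->.
Qed.

Definition heis_br (x y : heis) : heis :=
  let: (a, e, r, q, c, d, s) := x in
  let: (a', e', r', q', c', d', s') := y in
  (0, 0, (a - e) * r' - (a' - e') * r, (a - e) * q' - (a' - e') * q,
   e * c' - e' * c, e * d' - e' * d,
   a * s' - a' * s + (r * c' + q * d') - (r' * c + q' * d)).

Fact heis_br_linearl z : linear (heis_br^~ z).
Proof.
move: z => [[[[[[a e] r] q] c] d] s] k.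
move=> [[[[[[a' e'] r'] q'] c'] d'] s'] [[[[[[a2 e2] r2] q2] c2] d2] s2].
have [k' kE] := scale_as_mul k; apply: heis_eq; rewrite /= ?kE; ring.
Qed.
Fact heis_br_linearr z : linear (heis_br z).
Proof.
move: z => [[[[[[a e] r] q] c] d] s] k.
move=> [[[[[[a' e'] r'] q'] c'] d'] s'] [[[[[[a2 e2] r2] q2] c2] d2] s2].
have [k' kE] := scale_as_mul k; apply: heis_eq; rewrite /= ?kE; ring.
Qed.
Fact heis_brxx x : heis_br x x = 0.
Proof.
move: x => [[[[[[a e] r] q] c] d] s]; apply: heis_eq => /=; ring.
Qed.
Fact heis_jacobi x y z :
  heis_br x (heis_br y z) + heis_br y (heis_br z x) + heis_br z (heis_br x y)
    = 0.
Proof.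
move: x => [[[[[[a e] r] q] c] d] s]; move: y z.
move=> [[[[[[a' e'] r'] q'] c'] d'] s'] [[[[[[a2 e2] r2] q2] c2] d2] s2].
apply: heis_eq => /=; ring.
Qed.

HB.instance Definition _ := Lmodule_isLie.Build K heis
  heis_br_linearl heis_br_linearr heis_brxx heis_jacobi.

(** The two halves of the representation of chi(g).  Swapping and signing the
    coordinates in the column of the first makes its pairing with the row of the
    second, u v - v u, vanish; this is the relation [x, x^psi] = 0. *)
Definition meta_fst (x : meta) : heis :=
  let: (a, u, v) := x in (a, a, 0, 0, v, - u, 0).
Definition meta_snd (x : meta) : heis :=
  let: (a, u, v) := x in (a, 0, u, v, 0, 0, 0).

Lemma meta_fst_morphism : lie_morphism meta_fst.
Proof.
split=> [k [[a u] v] [[b u'] v']|[[a u] v] [[b u'] v']].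
  have [k' kE] := scale_as_mul k; apply: heis_eq; rewrite /= ?kE; ring.
apply: heis_eq => /=; ring.
Qed.
Lemma meta_snd_morphism : lie_morphism meta_snd.
Proof.
split=> [k [[a u] v] [[b u'] v']|[[a u] v] [[b u'] v']].
  have [k' kE] := scale_as_mul k; apply: heis_eq; rewrite /= ?kE; ring.
apply: heis_eq => /=; ring.
Qed.
Lemma meta_fst_snd x : lbr (meta_fst x) (meta_snd x) = 0.
Proof. move: x => [[a u] v]; apply: heis_eq => /=; ring. Qed.

(** The entries of the matrix of x with the last basis vector moved to the front,
    so that row 0 vanishes: the coordinate of index 0 is the quotient R of R^4,
    the other three span the submodule R^3. *)
Definition heis_entry (x : heis) (i j : nat) : R :=
  let: (a, e, r, q, c, d, s) := x in
  match i, j with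
  | 1%N, 0%N => s | 1%N, 1%N => a | 1%N, 2%N => r | 1%N, 3%N => q
  | 2%N, 0%N => c | 2%N, 2%N => e
  | 3%N, 0%N => d | 3%N, 3%N => e
  | _, _ => 0
  end.

Definition heis_mx (x : heis) : 'M[R]_4 := \matrix_(i, j) heis_entry x i j.
Definition heis_ker_mx (x : heis) : 'M[R]_3 :=
  \matrix_(i, j) heis_entry x i.+1 j.+1.

Lemma heis_entry_linear k x y i j :
  heis_entry (k *: x + y) i j = k *: heis_entry x i j + heis_entry y i j.
Proof.
move: x y => [[[[[[a e] r] q] c] d] s] [[[[[[a' e'] r'] q'] c'] d'] s'].
have Z : 0 = k *: 0 + 0 :> R by rewrite scaler0 addr0.
by case: i j => [|[|[|[|i]]]] [|[|[|[|j]]]].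
Qed.

Lemma heis_entry_lbr x y i j :
  heis_entry (lbr x y) i j =
    (heis_entry x i 0 * heis_entry y 0 j
     + heis_entry x i 1 * heis_entry y 1 j
     + heis_entry x i 2 * heis_entry y 2 j
     + heis_entry x i 3 * heis_entry y 3 j)
    - (heis_entry y i 0 * heis_entry x 0 j
       + heis_entry y i 1 * heis_entry x 1 j
       + heis_entry y i 2 * heis_entry x 2 j
       + heis_entry y i 3 * heis_entry x 3 j).
Proof.
move: x y => [[[[[[a e] r] q] c] d] s] [[[[[[a' e'] r'] q'] c'] d'] s'].
by case: i j => [|[|[|[|i]]]] [|[|[|[|j]]]] /=; ring.
Qed.

Lemma heis_mx_linear k x y :
  heis_mx (k *: x + y) = k%:A *: heis_mx x + heis_mx y.
Proof. by apply/matrixP => i j; rewrite !mxE heis_entry_linear mulr_algl. Qed.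
Lemma heis_ker_mx_linear k x y :
  heis_ker_mx (k *: x + y) = k%:A *: heis_ker_mx x + heis_ker_mx y.
Proof. by apply/matrixP => i j; rewrite !mxE heis_entry_linear mulr_algl. Qed.

Lemma heis_mx_lbr x y :
  heis_mx (lbr x y) = heis_mx x *m heis_mx y - heis_mx y *m heis_mx x.
Proof.
apply/matrixP => i j; rewrite !mxE !big_ord_recl !big_ord0 !mxE.
by rewrite heis_entry_lbr !addr0 !addrA.
Qed.
Lemma heis_ker_mx_lbr x y :
  heis_ker_mx (lbr x y)
    = heis_ker_mx x *m heis_ker_mx y - heis_ker_mx y *m heis_ker_mx x.
Proof.
apply/matrixP => i j; rewrite !mxE !big_ord_recl !big_ord0 !mxE.
have row0 z k : heis_entry z 0 k = 0 by move: z => [[[[[[? ?] ?] ?] ?] ?] ?].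
by rewrite heis_entry_lbr !row0 !mulr0 !add0r !addr0 !addrA.
Qed.

End MetaLie.

(** * Representations as modules over the enveloping algebra *)

Section Endomorphisms.
Variables (K : fieldType) (R : comAlgType K) (V : lmodType R).

(** The endomorphisms are R-linear, but form a vector space over K only: this is
    the target needed to extend a representation to terms over K. *)
Record endo := Endo { endo_fun :> V -> V; endo_linear : linear endo_fun }.

HB.instance Definition _ := gen_eqMixin endo.
HB.instance Definition _ := gen_choiceMixin endo.

Lemma endo_eq (f g : endo) : f =1 g -> f = g.
Proof.
move: f g => [f fl] [g gl] /= /funext fg; rewrite fg in fl *.
by congr Endo; apply: Prop_irrelevance.
Qed.

Fact endo0_linear : linear (fun _ : V => 0 : V).
Proof. by move=> a x y; rewrite scaler0 addr0. Qed.
Fact endoD_linear (f g : endo) : linear (fun v => f v + g v).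
Proof. by move=> a x y; rewrite !endo_linear scalerDr addrACA. Qed.
Fact endoN_linear (f : endo) : linear (fun v => - f v).
Proof. by move=> a x y; rewrite endo_linear opprD scalerN. Qed.
Fact endoZ_linear (k : K) (f : endo) : linear (fun v => k%:A *: f v).
Proof. by move=> a x y; rewrite endo_linear scalerDr !scalerA mulrC. Qed.
Fact endo_id_linear : linear (fun v : V => v).
Proof. by []. Qed.
Fact endo_comp_linear (f g : endo) : linear (fun v => f (g v)).
Proof. by move=> a x y; rewrite !endo_linear. Qed.

Definition endo_zero := Endo endo0_linear.
Definition endo_add f g := Endo (endoD_linear f g).
Definition endo_opp f := Endo (endoN_linear f).
Definition endo_scale k f := Endo (endoZ_linear k f).
Definition endo_id := Endo endo_id_linear.
Definition endo_comp f g := Endo (endo_comp_linear f g).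

Fact endo_addA : associative endo_add.
Proof. by move=> f g h; apply: endo_eq => v /=; rewrite addrA. Qed.
Fact endo_addC : commutative endo_add.
Proof. by move=> f g; apply: endo_eq => v /=; rewrite addrC. Qed.
Fact endo_add0 : left_id endo_zero endo_add.
Proof. by move=> f; apply: endo_eq => v /=; rewrite add0r. Qed.
Fact endo_addN : left_inverse endo_zero endo_opp endo_add.
Proof. by move=> f; apply: endo_eq => v /=; rewrite addNr. Qed.
HB.instance Definition _ :=
  GRing.isZmodule.Build endo endo_addA endo_addC endo_add0 endo_addN.

Fact endo_scaleA k l f : endo_scale k (endo_scale l f) = endo_scale (k * l) f.
Proof. by apply: endo_eq => v /=; rewrite scalerA -scalerAl mul1r scalerA. Qed.
Fact endo_scale1 : left_id 1 endo_scale.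
Proof. by move=> f; apply: endo_eq => v /=; rewrite !scale1r. Qed.
Fact endo_scaleDr : right_distributive endo_scale +%R.
Proof. by move=> k f g; apply: endo_eq => v /=; rewrite scalerDr. Qed.
Fact endo_scaleDl f : {morph endo_scale^~ f : k l / k + l}.
Proof. by move=> k l; apply: endo_eq => v /=; rewrite !scalerDl. Qed.
HB.instance Definition _ := GRing.Zmodule_isLmodule.Build K endo
  endo_scaleA endo_scale1 endo_scaleDr endo_scaleDl.

Lemma endo_comp_linearl h : linear (endo_comp^~ h).
Proof. by move=> k f g; apply: endo_eq. Qed.
Lemma endo_comp_linearr h : linear (endo_comp h).
Proof. by move=> k f g; apply: endo_eq => v /=; rewrite endo_linear. Qed.

End Endomorphisms.

Lemma linear_exists (S : pzRingType) (U W : lmodType S) (f : U -> W) :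
  linear f -> exists F : {linear U -> W}, F =1 f.
Proof.
move=> fl; pose F := GRing.isLinear.Build S U W *:%R f fl.
by exists (HB.pack_for {linear U -> W} f F).
Qed.

Section Representations.
Variables (K : fieldType) (R : comAlgType K) (L : lieAlgType K).

(** A representation over K by R-linear operators; R-linearity is what lets the
    tensor product over R with a matrix representation be formed. *)
Record lie_rep (V : lmodType R) := LieRep {
  rep_act :> L -> V -> V;
  rep_linear : forall x, linear (rep_act x);
  rep_linearl : forall k x y v,
    rep_act (k *: x + y) v = k%:A *: rep_act x v + rep_act y v;
  rep_lbr : forall x y v,
    rep_act (lbr x y) v = rep_act x (rep_act y v) - rep_act y (rep_act x v)
}.

(** The parameter rho is a phantom that makes the module structure over the
    enveloping algebra inferable from the type. *)
Definition rep_mod (V : lmodType R) (rho : lie_rep V) : Type := V.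

Section Module.
Variables (V : lmodType R) (rho : lie_rep V).

HB.instance Definition _ := GRing.Zmodule.copy (rep_mod rho) V.

Definition rep_op : uenv L -> endo V :=
  plift (@endo_comp K R V)
    (fun x => if x is Some x then Endo (rep_linear rho x) else endo_id V).

Lemma rep_rel_op s t : uenv_rel s t ->
  eval (@endo_comp K R V)
    (fun x => if x is Some x then Endo (rep_linear rho x) else endo_id V) s =
  eval (@endo_comp K R V)
    (fun x => if x is Some x then Endo (rep_linear rho x) else endo_id V) t.
Proof.
case=> {s t} /= [s t u|s|s|a x y|x y]; apply: endo_eq => v //=.
- exact: rep_linearl.
- exact: rep_lbr.
Qed.

Definition rep_scale (u : uenv L) (v : rep_mod rho) : rep_mod rho := rep_op u v.

Fact rep_scaleA u w v : rep_scale u (rep_scale w v) = rep_scale (u * w) v.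
Proof.
rewrite /rep_scale /rep_op -[u * w]/(pmul u w).
by rewrite (pliftM (@endo_comp_linearl _ _ V) (@endo_comp_linearr _ _ V)
  rep_rel_op).
Qed.
Fact rep_scale1 : left_id 1 rep_scale.
Proof.
move=> v; rewrite /rep_scale /rep_op.
by rewrite (plift_gen (@endo_comp_linearl _ _ V) (@endo_comp_linearr _ _ V)
  rep_rel_op).
Qed.
Fact rep_scaleDr : right_distributive rep_scale +%R.
Proof.
by move=> u v w; have := endo_linear (rep_op u) 1 v w; rewrite !scale1r.
Qed.
Fact rep_scaleDl v : {morph rep_scale^~ v : u w / u + w}.
Proof.
move=> u w; have := plift_linear (@endo_comp_linearl _ _ V)
  (@endo_comp_linearr _ _ V) rep_rel_op 1 u w.
by rewrite !scale1r /rep_scale /rep_op => ->.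
Qed.
HB.instance Definition _ := GRing.Zmodule_isLmodule.Build (uenv L) (rep_mod rho)
  rep_scaleA rep_scale1 rep_scaleDr rep_scaleDl.

Lemma rep_mod_in x (v : rep_mod rho) : uenv_in x *: v = rho x v.
Proof.
rewrite -[LHS]/(rep_op (uenv_in x) v) /rep_op.
by rewrite (plift_gen (@endo_comp_linearl _ _ V) (@endo_comp_linearr _ _ V)
  rep_rel_op).
Qed.

End Module.

Lemma rep_op_cls V (rho : lie_rep V) s :
  rep_op rho (pcls _ s) = eval (@endo_comp K R V)
    (fun x => if x is Some x then Endo (rep_linear rho x) else endo_id V) s.
Proof.
apply: plift_cls; [exact: endo_comp_linearl|exact: endo_comp_linearr|].
exact: rep_rel_op.
Qed.

Lemma rep_mod_linear (V W : lmodType R) (rho : lie_rep V) (sigma : lie_rep W)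
    (f : V -> W) :
    linear f -> (forall x v, f (rho x v) = sigma x (f v)) ->
  linear (f : rep_mod rho -> rep_mod sigma).
Proof.
move=> flin fequiv.
have fD v w : f (v + w) = f v + f w.
  by have := flin 1 v w; rewrite !scale1r.
have f0 : f 0 = 0 by apply/(addrI (f 0)); rewrite -fD !addr0.
have fZ a v : f (a *: v) = a *: f v.
  by rewrite -[a *: v]addr0 flin f0 addr0.
have fN v : f (- v) = - f v by rewrite -!(scaleN1r _) fZ.
have fop u v : f (rep_op rho u v) = rep_op sigma u (f v).
  elim/pcls_ind: u v => s; rewrite !rep_op_cls.
  elim: s => [[x|]||s IHs t IHt|s IHs|k s IHs|s IHs t IHt] v //=.
  - by rewrite fD IHs IHt.
  - by rewrite fN IHs.
  - by rewrite fZ IHs.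
  - by rewrite IHs IHt.
by move=> u v w; rewrite -[RHS]/(rep_op sigma u (f v) + f w) -fop -fD.
Qed.

Lemma zero_rep_linear (V : lmodType R) (x : L) : linear (fun _ : V => 0 : V).
Proof. by move=> a v w; rewrite scaler0 addr0. Qed.
Lemma zero_rep_linearl (V : lmodType R) k (x y : L) (v : V) :
  0 = k%:A *: 0 + 0 :> V.
Proof. by rewrite scaler0 addr0. Qed.
Lemma zero_rep_lbr (V : lmodType R) (x y : L) (v : V) : 0 = 0 - 0 :> V.
Proof. by rewrite subr0. Qed.
Definition zero_rep V : lie_rep V :=
  LieRep (@zero_rep_linear V) (@zero_rep_linearl V) (@zero_rep_lbr V).

Section Tensor.
Variables (V : lmodType R) (rho : lie_rep V) (n : nat) (h : L -> 'M[R]_n).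
Hypothesis h_linear : forall k x y, h (k *: x + y) = k%:A *: h x + h y.
Hypothesis h_lbr : forall x y, h (lbr x y) = h x *m h y - h y *m h x.

(** The tensor product over R of V with R^n, on which x acts by
    rho(x) (x) 1 + 1 (x) h(x). *)
Definition tensor_act (x : L) (v : {ffun 'I_n -> V}) : {ffun 'I_n -> V} :=
  [ffun i => rho x (v i) + \sum_j h x i j *: v j].

Fact tensor_linear x : linear (tensor_act x).
Proof.
move=> a v w; apply/ffunP => i; rewrite !ffunE rep_linear scalerDr addrACA.
congr (_ + _); rewrite scaler_sumr -big_split; apply: eq_bigr => j _ /=.
by rewrite !ffunE scalerDr !scalerA mulrC.
Qed.
Fact tensor_linearl k x y v :
  tensor_act (k *: x + y) v = k%:A *: tensor_act x v + tensor_act y v.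
Proof.
apply/ffunP => i; rewrite !ffunE rep_linearl scalerDr addrACA.
congr (_ + _); rewrite scaler_sumr -big_split; apply: eq_bigr => j _ /=.
by rewrite h_linear !mxE scalerDl scalerA.
Qed.
Fact tensor_lbr x y v :
  tensor_act (lbr x y) v
    = tensor_act x (tensor_act y v) - tensor_act y (tensor_act x v).
Proof.
have repD z (u w : V) : rho z (u + w) = rho z u + rho z w.
  by have := rep_linear rho z 1 u w; rewrite !scale1r.
have rep0 z : rho z 0 = 0 by apply/(addrI (rho z 0)); rewrite -repD !addr0.
have repZ z a u : rho z (a *: u) = a *: rho z u.
  by rewrite -[a *: u]addr0 rep_linear rep0 addr0.
have act2 z w i : tensor_act z (tensor_act w v) i =
    rho z (rho w (v i)) + \sum_j (h z *m h w) i j *: v j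
    + (\sum_j h w i j *: rho z (v j) + \sum_j h z i j *: rho w (v j)).
  rewrite !ffunE repD (big_morph (rho z) (repD z) (rep0 z)) -!addrA.
  congr (_ + _); rewrite [RHS]addrC -addrA; congr (_ + _).
    by apply: eq_bigr => j _; rewrite repZ.
  transitivity (\sum_j (h z i j *: rho w (v j)
                        + \sum_k (h z i j * h w j k) *: v k)).
    apply: eq_bigr => j _; rewrite ffunE scalerDr scaler_sumr.
    by congr (_ + _); apply: eq_bigr => k _; rewrite scalerA.
  rewrite big_split /=; congr (_ + _); rewrite exchange_big.
  by apply: eq_bigr => k _; rewrite mxE scaler_suml.
apply/ffunP => i.
have -> : (tensor_act x (tensor_act y v) - tensor_act y (tensor_act x v)) i
    = tensor_act x (tensor_act y v) i - tensor_act y (tensor_act x v) i.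
  by rewrite [in LHS]ffunE [X in _ + X]ffunE.
rewrite !act2 ffunE h_lbr rep_lbr.
rewrite [X in _ = _ - (_ + X)]addrC opprD addrACA subrr addr0.
rewrite opprD addrACA; congr (_ + _); rewrite -sumrB; apply: eq_bigr => j _.
by rewrite !mxE scalerBl.
Qed.

Definition tensor_rep : lie_rep {ffun 'I_n -> V} :=
  LieRep tensor_linear tensor_linearl tensor_lbr.

End Tensor.
End Representations.

(** * Shifting dimensions along an extension *)

Section DimensionShift.
Variables (K : fieldType) (R : comAlgType K) (L : lieAlgType K).
Variables (V : lmodType R) (rho : lie_rep L V).
Variables (H : L -> heis R) (Hmorph : lie_morphism H).

Let mx_linear k x y :
  heis_mx (H (k *: x + y)) = k%:A *: heis_mx (H x) + heis_mx (H y).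
Proof. by rewrite Hmorph.1 heis_mx_linear. Qed.
Let mx_lbr x y : heis_mx (H (lbr x y))
  = heis_mx (H x) *m heis_mx (H y) - heis_mx (H y) *m heis_mx (H x).
Proof. by rewrite Hmorph.2 heis_mx_lbr. Qed.
Let ker_mx_linear k x y : heis_ker_mx (H (k *: x + y))
  = k%:A *: heis_ker_mx (H x) + heis_ker_mx (H y).
Proof. by rewrite Hmorph.1 heis_ker_mx_linear. Qed.
Let ker_mx_lbr x y : heis_ker_mx (H (lbr x y))
  = heis_ker_mx (H x) *m heis_ker_mx (H y)
    - heis_ker_mx (H y) *m heis_ker_mx (H x).
Proof. by rewrite Hmorph.2 heis_ker_mx_lbr. Qed.

Definition heis_ext : lie_rep L {ffun 'I_4 -> V} :=
  tensor_rep rho mx_linear mx_lbr.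
Definition heis_ker : lie_rep L {ffun 'I_3 -> V} :=
  tensor_rep rho ker_mx_linear ker_mx_lbr.

Definition ker_incl (v : {ffun 'I_3 -> V}) : {ffun 'I_4 -> V} :=
  [ffun i => if unlift ord0 i is Some j then v j else 0].

Lemma ker_incl0 v : ker_incl v ord0 = 0.
Proof. by rewrite ffunE unlift_none. Qed.
Lemma ker_incl_lift v i : ker_incl v (lift ord0 i) = v i.
Proof. by rewrite ffunE liftK. Qed.

Lemma ker_incl_linear : linear ker_incl.
Proof.
move=> a v w; apply/ffunP => i; rewrite !ffunE.
by case: unlift => [j|]; rewrite ?ffunE // scaler0 addr0.
Qed.

Lemma ker_incl_inj : injective ker_incl.
Proof.
move=> v w vw; apply/ffunP => i.
by rewrite -[v i]ker_incl_lift vw ker_incl_lift.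
Qed.

Lemma ker_incl_equiv x v : ker_incl (heis_ker x v) = heis_ext x (ker_incl v).
Proof.
have rho0 : rho x 0 = 0.
  have := rep_linear rho x 1 0 0; rewrite !scale1r addr0 => /eqP.
  by rewrite -subr_eq subrr => /eqP <-.
apply/ffunP => i; case: (unliftP ord0 i) => [j|] ->.
  rewrite ker_incl_lift [LHS]ffunE [RHS]ffunE ker_incl_lift [in RHS]big_ord_recl.
  rewrite ker_incl0 scaler0 add0r.
  congr (_ + _); apply: eq_bigr => k _.
  by rewrite ker_incl_lift !mxE.
rewrite ker_incl0 [RHS]ffunE ker_incl0 rho0 add0r big1 // => j _.
by rewrite !mxE; case: (H x) => [[[[[[? ?] ?] ?] ?] ?] ?]; rewrite scale0r.
Qed.

Definition ext_proj (v : {ffun 'I_4 -> V}) : V := v ord0.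

Lemma ext_proj_linear : linear ext_proj.
Proof. by move=> a v w; rewrite /ext_proj !ffunE. Qed.

Lemma ext_proj_equiv x v : ext_proj (heis_ext x v) = rho x (ext_proj v).
Proof.
rewrite /ext_proj ffunE big1 ?addr0 // => j _.
by rewrite !mxE; case: (H x) => [[[[[[? ?] ?] ?] ?] ?] ?]; rewrite scale0r.
Qed.

Lemma ext_proj_ker v :
  ext_proj v = 0 -> v = ker_incl [ffun i => v (lift ord0 i)].
Proof.
move=> v0; apply/ffunP => i; case: (unliftP ord0 i) => [j|] ->.
  by rewrite ker_incl_lift ffunE.
by rewrite ker_incl0.
Qed.

(** One step of the comparison between a resolution and the iterated extension:
    f lifts to the extension because P0 is projective, and on boundaries the lift
    lands in the kernel of the projection. *)
Lemma heis_dimension_shift (P0 P1 : lmodType (uenv L)) (d : {linear P1 -> P0})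
    (f : {linear P0 -> rep_mod rho}) :
    projective P0 -> (forall q, f (d q) = 0) ->
  exists (phi : {linear P0 -> rep_mod heis_ext})
         (f' : {linear P1 -> rep_mod heis_ker}),
    (forall p, ext_proj (phi p) = f p) /\
    (forall q, phi (d q) = ker_incl (f' q)).
Proof.
move=> Pproj fd.
have [pi piE] := linear_exists (rep_mod_linear ext_proj_linear ext_proj_equiv).
have [iota iotaE] := linear_exists
  (rep_mod_linear ker_incl_linear ker_incl_equiv).
have [|phi phiE] := Pproj _ _ pi f.
  move=> v; exists ([ffun=> v] : {ffun 'I_4 -> V}).
  by rewrite piE /ext_proj ffunE.
pose f' q : rep_mod heis_ker := [ffun i => phi (d q) (lift ord0 i)].
have f'E q : phi (d q) = ker_incl (f' q).
  by apply: ext_proj_ker; rewrite -piE phiE fd.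
have f'_linear : linear f'.
  move=> u p q; apply: ker_incl_inj.
  by rewrite -f'E (linearP d) (linearP phi) !f'E -!iotaE (linearP iota).
have [F FE] := linear_exists f'_linear.
by exists phi, F; split=> [p|q]; rewrite ?FE // -piE phiE.
Qed.

Definition ker_corner (v : V) : {ffun 'I_3 -> V} :=
  [ffun i => if i == ord0 then v else 0].

(** An element acting trivially on V and mapped to the center of the Heisenberg
    algebra acts on the extension through the projection to V alone, so its
    effect does not depend on the chosen lift. *)
Lemma heis_ext_corner x r v :
    (forall w, rho x w = 0) -> H x = (0, 0, 0, 0, 0, 0, r) ->
  heis_ext x v = ker_incl (r *: ker_corner (ext_proj v)).
Proof.
move=> rho0 Hx; apply/ffunP => i; rewrite ffunE rho0 add0r Hx.
case: (unliftP ord0 i) => [j|] ->.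
  rewrite ker_incl_lift !ffunE big_ord_recl !mxE big1 => [|k _].
    by case: j => [[|[|[|//]]] ?]; rewrite /= ?scale0r ?scaler0 addr0.
  by rewrite mxE; case: j k => [[|[|[|//]]] ?] [[|[|[|//]]] ?];
    rewrite /= scale0r.
rewrite ker_incl0 big1 // => j _; rewrite mxE.
by rewrite /= scale0r.
Qed.

Lemma heis_ker_corner x r v :
    (forall w, rho x w = 0) -> H x = (0, 0, 0, 0, 0, 0, r) ->
  heis_ker x v = 0.
Proof.
move=> rho0 Hx; apply/ffunP => i; rewrite !ffunE rho0 add0r Hx big1 // => j _.
by rewrite mxE; case: i j => [[|[|[|//]]] ?] [[|[|[|//]]] ?];
  rewrite /= scale0r.
Qed.

End DimensionShift.

(** * Nonvanishing of the alternating sums *)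

Section AltsumPoly.
Variable F : idomainType.
Implicit Types (G : seq nat -> {poly F}) (s : seq nat).

(** The factors X^m occur with exponents at most x, so that B can be chosen
    independently of m. *)
Lemma altsum_size G s x : all (fun y => y < x)%N s ->
  exists B, forall m,
    (size (altsum (fun y t => 'X^m ^+ y.+1 * G t)%R s) <= m * x + B)%N.
Proof.
elim: s G => [|y s IHs] G /=; first by exists 0%N => m; rewrite size_poly0.
case/andP=> yx /IHs-/(_ (fun t => G (y :: t)))[B BE].
exists (maxn (size (G s)) B) => m.
apply: leq_trans (size_polyD _ _) _; rewrite size_polyN geq_max; apply/andP.
split; last by apply: leq_trans (BE m) _; rewrite leq_add2l leq_maxr.
apply: leq_trans (size_polyMleq _ _) _; rewrite -exprM size_polyXn addSn /=.
by apply: leq_add; [rewrite leq_mul2l yx orbT | apply: leq_maxl].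
Qed.

(** The term that removes the largest entry x carries the power m * (x + 1) of X;
    for m large it outweighs the other terms, whose powers are at most m * x. *)
Lemma altsum_neq0 G s x : all (fun y => y < x)%N s -> G s != 0 ->
  exists m, altsum (fun y t => 'X^m ^+ y.+1 * G t) (x :: s) != 0.
Proof.
move=> sx Gs; have [B BE] := altsum_size (fun t => G (x :: t)) sx.
exists B; rewrite /= subr_eq0; apply/eqP.
move=> /(congr1 (size : {poly F} -> nat)) E.
have := BE B; rewrite -E -exprM mulrC size_mulXn // mulnS [(B + _)%N]addnC.
by rewrite -[leqRHS]addn0 leq_add2l leqn0 size_poly_eq0 (negPf Gs).
Qed.

End AltsumPoly.

(** * Detection of commuting elements by a resolution *)

Section TrivialBase.
Variables (K : fieldType) (R : comAlgType K) (L : lieAlgType K).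

Lemma augm_linear : linear (augm (L := L) : uenv L -> K^o).
Proof.
apply: uenv_lift_linear => [a x y|x y]; first by rewrite scaler0 addr0.
by rewrite mulr0 subr0.
Qed.

(** The enveloping algebra acts on a trivial representation through the
    augmentation, so the trivial module K maps to it. *)
Lemma rep_op_zero (V : lmodType R) u v :
  rep_op (zero_rep L V) u v = (augm u)%:A *: v.
Proof.
have augm0 : augm (0 : uenv L) = 0.
  have /eqP := augmD (0 : uenv L) 0.
  by rewrite addr0 -subr_eq subrr eq_sym => /eqP.
have augmZ k (w : uenv L) : augm (k *: w) = k * augm w :> K.
  by have := augm_linear k w 0; rewrite addr0 => ->; rewrite augm0 addr0.
have augmN (w : uenv L) : augm (- w) = - augm w.
  by rewrite -scaleN1r augmZ mulN1r.
elim/pcls_ind: u v => s; rewrite rep_op_cls.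
elim: s => [[x|]||s IHs t IHt|s IHs|k s IHs|s IHs t IHt] v /=.
- by rewrite [augm _]augm_in !scale0r.
- by rewrite [augm _]augm1 !scale1r.
- by rewrite [augm _]augm0 !scale0r.
- by rewrite pcls_add [augm _]augmD !scalerDl IHs IHt.
- by rewrite pcls_opp [augm _]augmN !scaleNr IHs.
- by rewrite pcls_scale [augm _]augmZ IHs scalerA mulr_algl scalerA.
- rewrite pclsM [augm _]augmM IHt IHs scalerA.
  by rewrite mulr_algl scalerA.
Qed.

End TrivialBase.

Section Criterion.
Variables (K : fieldType) (L : lieAlgType K) (a : nat -> L).
Hypothesis a_comm : forall j k, lbr (a j) (a k) = 0.
Hypothesis a_heis : forall r : {poly K}, exists2 H : L -> heis {poly K},
  lie_morphism H & forall k, H (a k) = (0, 0, 0, 0, 0, 0, r ^+ k.+1).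

Local Notation ua k := (uenv_in (a k)).

Lemma uenv_a_comm j k : ua j * ua k = ua k * ua j.
Proof.
apply/eqP; rewrite -subr_eq0 -uenv_in_lbr a_comm.
have := uenv_in_linear (1 : K) (0 : L) 0; rewrite !scale1r addr0 => /eqP.
by rewrite -subr_eq subrr eq_sym.
Qed.

Variable P : proj_resolution (triv_mod L : lmodType (uenv L)).

(** The state of the induction at degree k.  Letting p be defined
    on lists of every length avoids types that depend on the length.  The list
    [k-1; ...; 0] decreases because [altsum_neq0] adds a largest entry in front.
    The boundary condition on p is kept in the form of the existence of the next
    stage, which treats degree 0 and positive degrees alike. *)
Definition koszul_detected k :=
  exists (V : lmodType {poly K}) (rho : lie_rep L V)
      (f : {linear res_mod P k -> rep_mod rho}) (p : seq nat -> res_mod P k)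
      (v : V) (delta : seq nat -> {poly K}),
    [/\ forall j w, rho (a j) w = 0,
        forall q, f (res_d P k q) = 0,
        forall s, exists q, res_d P k q = altsum (fun j t => ua j *: p t) s,
        (forall r : {poly K}, r *: v = 0 -> r = 0)
          /\ (forall s, f (p s) = delta s *: v)
      & delta (rev (iota 0 k)) != 0].

Lemma koszul_detected0 : koszul_detected 0.
Proof.
pose V : lmodType {poly K} := {poly K}^o.
pose f0 (x : res_mod P 0) : rep_mod (zero_rep L V) := (res_aug P x : K)%:P.
have f0_linear : linear f0.
  move=> u x y; rewrite /f0 linearP polyCD.
  congr (_ + _); rewrite -[RHS]/(rep_op _ u _) rep_op_zero.
  by rewrite polyCM -alg_polyC.
have [f fE] := linear_exists f0_linear.
have [p0 p0E] := res_aug_surj P (1 : K).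
exists V, (zero_rep L V), f, (fun _ => p0), 1, (fun _ => 1); split=> //.
- move=> q; rewrite fE /f0.
  by have -> : res_aug P (res_d P 0 q) = 0 by apply/res_exact0; exists q.
- move=> s; apply/res_exact0.
  rewrite (altsum_morph _ _ (linearB (res_aug P))).
  rewrite (@eq_altsum _ _ (fun _ _ => 0)).
    by elim: s => //= _ s IHs; rewrite IHs subr0.
  move=> j t; rewrite [LHS](linearZ_LR (res_aug P)) -[LHS]/(augm _ * _).
  by rewrite augm_in; apply: mul0r.
- split=> [r|s]; first by rewrite -[_ *: _]/(r * 1) mulr1.
  by rewrite fE /f0 p0E scale1r.
- exact: oner_neq0.
Qed.

(** The value of f' at p'(s) is computed through the lift phi: it is
    phi(d p'(s)), an alternating sum of the a_j applied to lifts of f(p(t)), where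
    [heis_ext_corner] applies. *)
Lemma koszul_detectedS k : koszul_detected k -> koszul_detected k.+1.
Proof.
move=> [V [rho [f [p [v [delta [rho0 fd pd [v_free fp] delta_neq0]]]]]]].
have [|m mE] := @altsum_neq0 K delta (rev (iota 0 k)) k _ delta_neq0.
  by rewrite all_rev; apply/allP => j; rewrite mem_iota.
have [H Hm Ha] := a_heis 'X^m.
have [phi [f' [phiE f'E]]] := heis_dimension_shift Hm (@res_proj _ _ P k) fd.
have [p' p'E] := choice pd.
exists _, (heis_ker rho Hm), f', p', (ker_corner v).
exists (altsum (fun j t => 'X^m ^+ j.+1 * delta t)); split.
- by move=> j w; apply: heis_ker_corner (Ha j).
- move=> q; apply: ker_incl_inj; rewrite -f'E.
  have -> : res_d P k (res_d P k.+1 q) = 0 by apply/res_exactS; exists q.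
  rewrite linear0; apply/ffunP => i; rewrite !ffunE.
  by case: unlift => // j; rewrite ffunE.
- move=> s; apply/res_exactS.
  rewrite (altsum_morph _ _ (linearB (res_d P k))).
  rewrite -(@altsum_altsum _ (fun i j t => (ua i * ua j) *: p t) s).
    apply: eq_altsum => j t; rewrite [LHS](linearZ_LR (res_d P k)) p'E.
    rewrite (altsum_morph _ _ (scalerBr (ua j))).
    by apply: eq_altsum => i u; rewrite scalerA.
  by move=> i j t; rewrite uenv_a_comm.
- split=> [r /ffunP/(_ ord0)|s].
    by rewrite !ffunE; apply: v_free.
  apply: ker_incl_inj; rewrite -f'E p'E.
  rewrite (altsum_morph _ _ (linearB phi)).
  transitivity (altsum (fun j t =>
      ker_incl (('X^m ^+ j.+1 * delta t) *: ker_corner v)) s).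
    apply: eq_altsum => j t; rewrite [LHS](linearZ_LR phi) rep_mod_in.
    rewrite (heis_ext_corner Hm _ (rho0 j) (Ha j)) phiE fp.
    congr ker_incl; apply/ffunP => i; rewrite !ffunE.
    by case: ifP; rewrite ?scaler0 // scalerA.
  rewrite -(altsum_morph (f := fun r => ker_incl (r *: ker_corner v))) //.
  move=> r r' /=; apply/ffunP => i; rewrite !ffunE.
  by case: unlift => [j|]; rewrite ?subr0 // !ffunE scalerBl.
- by rewrite -[k.+1]addn1 iotaD cats1 rev_rcons.
Qed.

Lemma koszul_detected_all k : koszul_detected k.
Proof. by elim: k => [|k]; [apply: koszul_detected0|apply: koszul_detectedS]. Qed.

End Criterion.

(** If P vanished in degree n + 1, the detected element p(s) would be zero, while
    f maps it to a nonzero multiple of a torsion-free vector. *)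
Lemma infinite_cohom_dim_heis (K : fieldType) (L : lieAlgType K)
    (a : nat -> L) :
    (forall j k, lbr (a j) (a k) = 0) ->
    (forall r : {poly K}, exists2 H : L -> heis {poly K},
       lie_morphism H & forall k, H (a k) = (0, 0, 0, 0, 0, 0, r ^+ k.+1)) ->
  infinite_cohom_dim L.
Proof.
move=> a_comm a_heis n [P P0].
have [V [rho [f [p [v [delta [_ _ _ [v_free fp]]]]]]]] :=
  koszul_detected_all a_comm a_heis P n.+1.
case/eqP; apply: v_free.
by rewrite -fp (P0 _ (ltnSn n) (p _)) linear0.
Qed.

(** * The representations of chi(g) *)

Section ChiToHeis.
Variables (K : fieldType) (R : comAlgType K) (g : lieAlgType K).

Lemma chi_heis_lift (phi : g -> meta R) : lie_morphism phi ->
  exists H : chi g -> heis R, [/\ lie_morphism H,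
    forall x, H (chi_in x) = meta_fst (phi x)
    & forall x, H (chi_psi x) = meta_snd (phi x)].
Proof.
move=> phim.
have [||x|H HP _] := @chi_lift K g (heis R)
  (@meta_fst K R \o phi) (@meta_snd K R \o phi).
- exact: lie_morphism_comp phim (meta_fst_morphism R).
- exact: lie_morphism_comp phim (meta_snd_morphism R).
- exact: meta_fst_snd.
by exists H.
Qed.

(** The corner of the image of chi_alt is the determinant of the three triples
    phi x, phi y, phi z, here r; each further bracket with x multiplies it by
    r. *)
Lemma heis_chi_orbit (phi : g -> meta R) (H : chi g -> heis R) x y z r k :
    lie_morphism H ->
    (forall u, H (chi_in u) = meta_fst (phi u)) ->
    (forall u, H (chi_psi u) = meta_snd (phi u)) ->
    phi x = (r, 0, 0) -> phi y = (0, 1, 0) -> phi z = (0, 0, 1) ->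
  H (chi_orbit x y z k) = (0, 0, 0, 0, 0, 0, r ^+ k.+1).
Proof.
move=> [Hlin Hbr] Hi Hp px py pz.
have HB u v : H (u - v) = H u - H v.
  by rewrite addrC -scaleN1r Hlin scaleN1r addrC.
elim: k => [|k IHk]; rewrite [LHS]Hbr Hi px.
  rewrite Hbr HB Hi !Hp py pz; apply: heis_eq => /=; ring.
by rewrite IHk; apply: heis_eq; rewrite /= ?(exprS r k.+1); ring.
Qed.

End ChiToHeis.

Theorem corollary1p5 (K : fieldType) (hchar : 2%N \notin [pchar K]%R)
    (g : lieAlgType K) (X : Type) (i : X -> g)
    (hfree : free_on i)
    (hnonab : ~ lie_abelian g)
    (hrank : exists f : 'I_3 -> X, injective f) :
  infinite_cohom_dim (chi g).
Proof.
have [f f_inj] := hrank.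
pose x := i (f (inord 0)); pose y := i (f (inord 1)); pose z := i (f (inord 2)).
apply: (@infinite_cohom_dim_heis K (chi g) (chi_orbit x y z)).
  exact: chi_orbit_comm.
move=> r.
pose psi c : meta {poly K} :=
  if `[< c = f (inord 0) >] then (r, 0, 0) else
  if `[< c = f (inord 1) >] then (0, 1, 0) else
  if `[< c = f (inord 2) >] then (0, 0, 1) else 0.
have [phi [phim phiE] _] := hfree (meta {poly K}) psi.
have [H [Hm Hi Hp]] := chi_heis_lift phim.
have fE j k : (j < 3)%N -> (k < 3)%N ->
    `[< f (inord j) = f (inord k) >] = (j == k).
  move=> j3 k3; apply/asboolP/eqP => [/f_inj/(congr1 (@nat_of_ord 3))|-> //].
  by rewrite !inordK.
by exists H => // k; apply: (heis_chi_orbit k Hm Hi Hp); rewrite phiE /psi !fE.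
Qed.
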